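(* For every $d\ge 2$, the sequence $(\beta_{\mathrm{TF}_g}^d)_{g\ge 3}$ is strictly increasing: $$\beta_{\mathrm{TF}_3}^d<\beta_{\mathrm{TF}_4}^d<\beta_{\mathrm{TF}_5}^d<\cdots .$$
   Context: Let $x_1,x_2,\dots$ be independent uniformly random points of $[0,1]^d$ and $\mathcal{X}_n=\{x_1,\dots,x_n\}$. All lengths are Euclidean. A 2-factor of a finite point set $X$ is a collection of vertex-disjoint cycles (each with at least 3 vertices) covering all points of $X$. For $g\ge 3$, $\mathrm{TF}_g(X)$ is the minimum total length of a 2-factor of $X$ all of whose cycles have at least $g$ vertices (the covering requirement is imposed only when $|X|\ge g$). $\beta_{\mathrm{TF}_g}^d$ is the constant such that $\mathrm{TF}_g(\mathcal{X}_n)/n^{(d-1)/d}\to\beta_{\mathrm{TF}_g}^d$ almost surely (which exists). *)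

(* Defs.v *)
From HB Require Import structures.
From mathcomp Require Import all_boot all_order all_algebra finmap.
From mathcomp Require Import all_classical all_reals all_analysis.

Set Implicit Arguments.
Unset Strict Implicit.
Unset Printing Implicit Defensive.

Import Order.TTheory GRing.Theory Num.Theory.
Import numFieldNormedType.Exports.

Local Open Scope classical_set_scope.
Local Open Scope ring_scope.

(* Points of R^d are d-tuples, since these carry the Borel sigma-algebra
   generated by the coordinates. *)

Definition edist (R : realType) (d : nat) (x y : d.-tuple R) : R :=
  Num.sqrt (\sum_(k < d) (tnth x k - tnth y k) ^+ 2).

(* A cycle is a duplicate-free sequence c of vertices, read cyclically: its
   edges join each x in c to [next c x]. *)
Definition cycle_length (R : realType) (d : nat) (c : seq (d.-tuple R)) : R :=
  \sum_(x <- c) edist x (next c x).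

(* A collection of cycles is a sequence of cycles; uniqueness of its flattening
   says that each cycle is duplicate-free and that they are vertex-disjoint. *)
Definition disjoint_cycles_in (R : realType) (d : nat)
    (X : {fset d.-tuple R}) (C : seq (seq (d.-tuple R))) : Prop :=
  [/\ forall c, c \in C -> (3 <= size c)%N,
      uniq (flatten C) &
      {subset flatten C <= X}].

Definition collection_length (R : realType) (d : nat)
    (C : seq (seq (d.-tuple R))) : R :=
  \sum_(c <- C) cycle_length c.

(* For #|` X | < g the only feasible collection is the empty one. *)
Definition TF_feasible (R : realType) (d g : nat)
    (X : {fset d.-tuple R}) (C : seq (seq (d.-tuple R))) : Prop :=
  [/\ disjoint_cycles_in X C,
      forall c, c \in C -> (g <= size c)%N &
      (g <= #|` X |)%N -> {subset X <= flatten C}].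

(* The infimum is a minimum: the set below is finite, and it is nonempty
   because any enumeration of X is a Hamilton cycle when 3 <= g <= #|` X |. *)
Definition TF (R : realType) (d g : nat) (X : {fset d.-tuple R}) : R :=
  inf [set collection_length C | C in [set C | TF_feasible g X C]].

Definition uniform_cube (R : realType) (d : nat) (disp : measure_display)
    (T : measurableType disp) (P : probability T R)
    (X : {RV P >-> d.-tuple R}) : Prop :=
  forall A : 'I_d -> set R, (forall k, measurable (A k)) ->
    distribution P X [set x | forall k, A k (tnth x k)] =
    (\prod_(k < d) uniform_prob (@ltr01 R) (A k))%E.

Definition independent_RVs (R : realType) (disp disp' : measure_display)
    (T : measurableType disp) (T' : measurableType disp')
    (P : probability T R) (X : nat -> {RV P >-> T'}) : Prop :=
  forall (J : {fset nat}) (A : nat -> set T'), (forall i, measurable (A i)) ->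
    P (\bigcap_(i in [set` J]) (X i @^-1` A i)) =
    (\prod_(i <- J) P (X i @^-1` A i))%E.

(* The random points are indexed from 0. *)
Definition random_points (R : realType) (d : nat) (disp : measure_display)
    (T : measurableType disp) (P : probability T R)
    (X : nat -> {RV P >-> d.-tuple R}) (n : nat) (w : T) : {fset d.-tuple R} :=
  [fset X i w | i in iota 0 n]%fset.

Definition is_beta_TF (R : realType) (d : nat) (disp : measure_display)
    (T : measurableType disp) (P : probability T R)
    (X : nat -> {RV P >-> d.-tuple R}) (g : nat) (b : R) : Prop :=
  {ae P, forall w : T,
    TF g (random_points X n w) / n%:R `^ ((d%:R - 1) / d%:R) @[n --> \oo]
      --> b}.

(* Main.v *)
Require Import Defs.
From HB Require Import structures.
From mathcomp Require Import all_boot all_order all_algebra finmap.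
From mathcomp Require Import all_classical all_reals all_analysis.
From mathcomp Require Import measurable_realfun lra ring zify.

(* Divide the cube into n = q^d cells.  With probability bounded away from 0 a
   given cell contains a "gadget" and no other sample point: m tiny clusters of
   exactly g points each, mutually at distance at least omega, all within K of
   the centre p of the cell, where K is small compared with m omega (a square
   array of clusters) and the distance D from p to the walls is huge.

   A 2-factor with all cycles longer than g has no cycle inside a cluster, so
   some arc leaves each cluster.  Cut its cycles at the gadget into r runs of
   outer points.  If r <= 2, let every run close up through one cluster and turn
   the other clusters into g-cycles: this costs O(g K) and saves about m omega.
   If r >= 3, two of three directions seen from p make an angle of at most 120
   degrees, so joining the corresponding runs directly saves D / 4, and all runs
   and the gadget can be put on one long cycle.  Either way the 2-factor becomes
   shorter by a constant times 1/q, its cycles have at least g vertices, and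
   every new cycle meets this gadget, so the argument applies to the remaining
   gadgets in turn.

   Hence (TF_(g+1) - TF_g) / n^((d-1)/d) is at least a constant times the
   proportion of gadget cells, whose expectation is bounded below.  If the limit
   were <= 0 this proportion would tend to 0 almost surely, hence in mean by
   dominated convergence. *)

Set Implicit Arguments.
Unset Strict Implicit.
Unset Printing Implicit Defensive.

Import Order.TTheory GRing.Theory Num.Theory.
Import numFieldNormedType.Exports.

Local Open Scope classical_set_scope.
Local Open Scope ring_scope.

(* MathComp-Analysis exports an unrelated, extended-real [edist]. *)
Local Notation edist := Defs.edist.

(** * Sums over cycles and runs *)

Lemma uniq_flatten_mem (T : eqType) (C : seq (seq T)) c :
  uniq (flatten C) -> c \in C -> uniq c.
Proof.
move=> + cC; rewrite (perm_uniq (perm_flatten (perm_to_rem cC))) /= cat_uniq.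
by case/and3P.
Qed.

Lemma size_flatten_const (T : eqType) (C : seq (seq T)) n :
  {in C, forall c, size c = n} -> size (flatten C) = (size C * n)%N.
Proof.
elim: C => //= c C IH Cn; rewrite size_cat mulSn Cn ?mem_head// IH// => c' cC.
by apply: Cn; rewrite inE cC orbT.
Qed.

Section CycleSums.
Variables (R : realFieldType) (T : eqType).
Implicit Types (w : T -> T -> R) (c s : seq T) (C Qs : seq (seq T)).

Fixpoint path_sum w x s : R :=
  if s is y :: s' then w x y + path_sum w y s' else 0.

Definition cycle_sum w c : R := \sum_(x <- c) w x (next c x).

Lemma path_sum_cat w x s1 s2 :
  path_sum w x (s1 ++ s2) = path_sum w x s1 + path_sum w (last x s1) s2.
Proof. by elim: s1 x => [|y s1 IH] x /=; rewrite ?add0r// IH addrA. Qed.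

Lemma path_sum_nth w x s :
  path_sum w x s = \sum_(i < size s) w (nth x (x :: s) i) (nth x s i).
Proof.
elim: s x => [|y s IH] x /=; first by rewrite big_ord0.
rewrite big_ord_recl /= IH; congr (_ + _); apply: eq_bigr => i _ /=.
by congr (w _ _); apply: set_nth_default; rewrite //= ltnS ltnW.
Qed.

Lemma cycle_sumE w x s :
  uniq (x :: s) -> cycle_sum w (x :: s) = path_sum w x (rcons s x).
Proof.
move=> us; rewrite path_sum_nth /cycle_sum size_rcons (big_nth x) big_mkord.
apply: eq_bigr => i _; congr (w _ _).
  by rewrite -rcons_cons nth_rcons (ltn_ord i).
rewrite next_nth mem_nth ?index_uniq ?ltn_ord// nth_rcons.
case: ltngtP => // si; rewrite nth_default ?si//.
exact: ltnW.
Qed.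

Lemma cycle_sum_rot w n c : uniq c -> cycle_sum w (rot n c) = cycle_sum w c.
Proof.
move=> uc; rewrite /cycle_sum (perm_big c) ?perm_rot//.
by apply: eq_bigr => x _; rewrite next_rot.
Qed.

Lemma cycle_sumD w1 w2 c :
  cycle_sum (fun x y => w1 x y + w2 x y) c = cycle_sum w1 c + cycle_sum w2 c.
Proof. exact: big_split. Qed.

(** If no arc left [P], following [next] from a vertex in [P] would carry [P] around the whole
    cycle. *)
Lemma leaving_arc (P : pred T) c : uniq c -> has P c -> ~~ all P c ->
  has (fun x => P x && ~~ P (next c x)) c.
Proof.
move=> uc hP; apply: contraR => /hasPn noarc.
have [x xc Px] := hasP hP; have [i s Ec] := rot_to xc.
have: fcycle (next c) (rot i c) by rewrite rot_cycle cycle_next.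
rewrite -(perm_all P (permEl (perm_rot i c))) Ec /= rcons_path => /andP[+ _].
have : {subset x :: s <= c} by move=> y; rewrite -Ec mem_rot.
rewrite Px /=; elim: s x Px {xc Ec} => //= y s IH x Px sub /andP[/eqP nxy pys].
have Py : P y.
  by have := noarc x (sub x (mem_head _ _)); rewrite Px nxy negbK.
by rewrite Py /=; apply: IH pys => // z zs; apply: sub; rewrite inE zs orbT.
Qed.

(** Charging each cluster to the arcs that leave it makes the number of clusters a sum along
    cycles. *)
Definition leaving_weight (Ps : seq (seq T)) x y : R :=
  \sum_(P <- Ps) ((x \in P) && (y \notin P))%:R.

(** A cluster is nonempty, so it meets a cycle; that cycle is not contained in it and has an arc
    leaving it. After exchanging the sums, each cluster contributes at least 1. *)
Lemma leaving_weight_sum (Ps : seq (seq T)) C : uniq (flatten C) ->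
  {in Ps, forall P, P != [::] /\ {subset P <= flatten C}} ->
  {in C & Ps, forall c P, ~~ all (mem P) c} ->
  (size Ps)%:R <= \sum_(c <- C) cycle_sum (leaving_weight Ps) c.
Proof.
move=> uC Psub nall; rewrite /cycle_sum /leaving_weight.
under eq_bigr => c _ do rewrite exchange_big.
rewrite exchange_big /= -sum1_size natr_sum.
rewrite big_seq [leRHS]big_seq; apply: ler_sum => P PPs.
have [+ subP] := Psub _ PPs; case: P PPs subP => // x P PPs subP _.
have /flattenP[c cC xc] := subP x (mem_head _ _).
have uc := uniq_flatten_mem uC cC.
have hc : has (mem (x :: P)) c by apply/hasP; exists x => //=; rewrite mem_head.
have /hasP[y yc /= /andP[yP nyP]] := leaving_arc uc hc (nall _ _ cC PPs).
rewrite (big_rem c)//= (big_rem y)//= yP nyP -addrA lerDl.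
by apply: addr_ge0; apply: sumr_ge0 => // ? _; apply: sumr_ge0.
Qed.

Section Runs.
Variables (e : T -> T -> R) (D : T -> R) (S : pred T).

(** The length of a run closed up through a hub, where [D] is the distance to the hub. *)
Definition run_cost s : R :=
  if s is x :: s' then D x + path_sum e x s' + D (last x s') else 0.

(** Consecutive runs are joined directly; each joining edge is at most the two legs through the
    hub. *)
Lemma cycle_sum_flatten Qs : (forall x y, e x y <= D x + D y) ->
  uniq (flatten Qs) -> cycle_sum e (flatten Qs) <= \sum_(Q <- Qs) run_cost Q.
Proof.
move=> eD.
have join x z Qs' : path_sum e x (rcons (flatten Qs') z) <=
    D x + \sum_(Q <- Qs') run_cost Q + D z.
  elim: Qs' x => [|[|y q] Qs' IH] x /=.
  - by rewrite big_nil !addr0.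
  - by rewrite big_cons add0r.
  rewrite rcons_cat path_sum_cat big_cons /=.
  have := IH (last y q); have := eD x y; lra.
elim: Qs => [|[|x q] Qs IH] /= uQ.
- by rewrite /cycle_sum !big_nil.
- by rewrite big_cons add0r IH.
rewrite cycle_sumE// rcons_cat path_sum_cat big_cons /=.
have := join (last x q) x Qs; lra.
Qed.

Variables a b : R.

(** The worth of an edge once the cycle is cut at [S]: an edge between [S] and an outer point stands
    for the leg from that point to the hub, less [a] on entering [S] and [b] on leaving it. The
    corrections differ because a leaving edge is also charged for its cluster. *)
Definition cut_weight x y : R :=
  if S x then (if S y then 0 else D y - b)
  else (if S y then D x - a else e x y).

(** Induction on [s] for both kinds of start. If [x] is outside [S], then [x :: Q] is the rest of a
    run whose first leg belongs to an earlier arc; ending this run uses up a point of [S], hence the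
    strict inequality. *)
Lemma path_runs x s z : S z ->
  if S x then
    exists Qs, [/\ [::] \notin Qs, flatten Qs = seq.filter (predC S) s,
      (size Qs <= count S (rcons s z))%N &
      path_sum cut_weight x (rcons s z) = \sum_(Q <- Qs) (run_cost Q - a - b)]
  else
    exists Q Qs, [/\ [::] \notin Qs, Q ++ flatten Qs = seq.filter (predC S) s,
      (size Qs < count S (rcons s z))%N &
      path_sum cut_weight x (rcons s z) = path_sum e x Q + D (last x Q) - a +
        \sum_(R <- Qs) (run_cost R - a - b)].
Proof.
move=> Sz; elim: s x => [|y s IH] x.
  case Sx: (S x).
    by exists [::]; split=> //=; rewrite ?big_nil /cut_weight Sx Sz ?addr0.
  exists [::], [::]; split=> //=; rewrite ?Sz//.
  by rewrite big_nil /cut_weight Sx Sz !addr0 add0r.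
have := IH y; case Sx: (S x); case Sy: (S y); rewrite /= Sy /=.
- move=> [Qs [n0 EQ sQ wQ]]; exists Qs; split=> //; first by rewrite ltnW.
  by rewrite wQ /cut_weight Sx Sy add0r.
- move=> [Q [Qs [n0 EQ sQ wQ]]]; exists ((y :: Q) :: Qs); split=> //=.
    by rewrite EQ.
  by rewrite wQ big_cons /= /cut_weight Sx Sy; lra.
- move=> [Qs [n0 EQ sQ wQ]]; exists [::], Qs; split=> //=.
  by rewrite wQ /= /cut_weight Sx Sy; lra.
- move=> [Q [Qs [n0 EQ sQ wQ]]]; exists (y :: Q), Qs; split=> //=.
    by rewrite EQ.
  by rewrite wQ /= /cut_weight Sx Sy; lra.
Qed.

(** [U] collects the cycles that miss [S]. Any other cycle is rotated to start in [S], which makes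
    it a path from [S] to [S]. *)
Lemma collection_runs C : uniq (flatten C) ->
  exists U Qs, [/\ {subset U <= C}, {in U, forall c, ~~ has S c},
    [::] \notin Qs /\ (size Qs <= count S (flatten C))%N,
    perm_eq (flatten U ++ flatten Qs) (seq.filter (predC S) (flatten C)) &
    \sum_(c <- C) cycle_sum cut_weight c =
    \sum_(c <- U) cycle_sum e c + \sum_(Q <- Qs) (run_cost Q - a - b)].
Proof.
elim: C => [_|c C IH /=].
  by exists [::], [::]; split; rewrite ?big_nil// addr0.
rewrite cat_uniq => /and3P[uc _ /IH[U [Qs [UC US [Q0 sQ] pU wU]]]].
rewrite big_cons wU; case hc: (has S c); last first.
  exists (c :: U), Qs; split=> /=.
  - move=> x; rewrite !inE => /orP[->//|/UC ->]; exact: orbT.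
  - by move=> x; rewrite inE => /orP[/eqP->|/US//]; rewrite hc.
  - by rewrite count_cat (leq_trans sQ) ?leq_addl.
  - rewrite filter_cat -catA perm_cat//.
    have -> // : seq.filter (predC S) c = c.
    by apply/all_filterP; rewrite all_predC hc.
  rewrite big_cons -addrA; congr (_ + _).
  have nS x : x \in c -> S x = false.
    by move=> xc; apply: contraFF hc => Sx; apply/hasP; exists x.
  rewrite /cycle_sum; apply: eq_big_seq => x xc.
  by rewrite /cut_weight !nS ?mem_next.
have [x xc Sx] := hasP hc; have [i s Ec] := rot_to xc.
have := path_runs x s Sx; rewrite Sx => -[Qs' [n0 EQ sQ' wQ]].
exists U, (Qs' ++ Qs); split=> //.
- by move=> y /UC; rewrite inE orbC => ->.
- rewrite mem_cat negb_or n0 Q0; split=> //.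
  rewrite size_cat count_cat leq_add// (leq_trans sQ')//.
  rewrite -(permP (permEl (perm_rot i c))) Ec -cats1 count_cat /= addn0.
  by rewrite addnC.
- rewrite flatten_cat filter_cat perm_catCA perm_cat// EQ.
  have -> : seq.filter (predC S) s = seq.filter (predC S) (rot i c).
    by rewrite Ec /= Sx.
  by apply: perm_filter; rewrite perm_rot.
rewrite big_cat /= addrCA; congr (_ + _).
have uxs : uniq (x :: s) by rewrite -Ec rot_uniq.
by rewrite -(cycle_sum_rot _ i uc) Ec cycle_sumE// wQ.
Qed.

End Runs.
End CycleSums.

(** * Surgery at one gadget *)

Section Surgery.
Variables (R : realFieldType) (T : eqType) (e : T -> T -> R).
Hypothesis e_ge0 : forall x y, 0 <= e x y.
Hypothesis e_sym : forall x y, e x y = e y x.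
Hypothesis e_tri : forall x y z, e x z <= e x y + e y z.
Implicit Types (C Ps Qs : seq (seq T)) (p : T).

Lemma path_sum_rev x s :
  path_sum e (last x s) (rev (belast x s)) = path_sum e x s.
Proof.
elim: s x => //= y s IH x; rewrite rev_cons -cats1 path_sum_cat IH /= addr0.
suff -> : last (last y s) (rev (belast y s)) = y by rewrite e_sym addrC.
have : last y (rev (y :: s)) = y by rewrite rev_cons last_rcons.
by rewrite lastI rev_rcons.
Qed.

Lemma cycle_sum_via p s : uniq s ->
  cycle_sum e s <= \sum_(x <- s) 2 * e p x.
Proof.
move=> us; rewrite -{1}(flatten_seq1 s).
have eD x y : e x y <= e p x + e p y by rewrite (e_sym p); exact: e_tri.
apply: le_trans (cycle_sum_flatten eD _) _; first by rewrite flatten_seq1.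
rewrite big_map; apply: ler_sum => x _; rewrite /run_cost /=; lra.
Qed.

(** Reversing the first run brings the two heads together, so their legs to [p] are replaced by the
    edge between them. *)
Lemma run_cost_rev_cat p x s y t :
  run_cost e (e p) (rev (x :: s) ++ y :: t) =
  run_cost e (e p) (x :: s) + run_cost e (e p) (y :: t) -
  (e p x + e p y - e x y).
Proof.
rewrite {1}lastI rev_rcons /= path_sum_cat path_sum_rev last_cat /=.
suff -> : last (last x s) (rev (belast x s)) = x by lra.
have : last x (rev (x :: s)) = x by rewrite rev_cons last_rcons.
by rewrite lastI rev_rcons.
Qed.

(** Each run takes a cluster of its own, at cost at most [2 * K] per cluster point; each cluster
    left over becomes a cycle, at cost at most [2 * rho] per point. *)
Lemma absorb_runs p K rho g Ps Qs : 0 <= rho ->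
  {in Ps, forall P, size P = g} ->
  {in flatten Ps, forall x, e p x <= K} ->
  {in Ps, forall P, {in P &, forall x y, e x y <= rho}} ->
  (size Qs <= size Ps)%N -> uniq (flatten Qs ++ flatten Ps) ->
  exists C, [/\ perm_eq (flatten C) (flatten Qs ++ flatten Ps),
    {in C, forall c, exists Q, exists2 P, P \in Ps & c = Q ++ P} &
    \sum_(c <- C) cycle_sum e c <=
    \sum_(Q <- Qs) run_cost e (e p) Q + (size Qs)%:R * (2 * K * g%:R) +
    (size Ps)%:R * (2 * rho * g%:R)].
Proof.
move=> rho0; elim: Ps Qs => [|P Ps IH] Qs sP PK Prho.
  case: Qs => // _ _; exists [::]; split=> //.
  by rewrite !big_nil !mul0r !addr0.
have PPs : P \in P :: Ps by rewrite mem_head.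
have PsPs P' : P' \in Ps -> P' \in P :: Ps by rewrite inE orbC => ->.
have PK' : {in flatten Ps, forall x, e p x <= K}.
  by move=> x xPs; apply: PK; rewrite /= mem_cat xPs orbT.
have {PK'}IH Qs' := IH Qs' (fun P' h => sP P' (PsPs P' h)) PK'
  (fun P' h => Prho P' (PsPs P' h)).
case: Qs => [|Q Qs] /=; rewrite ?ltnS => sQ.
  rewrite cat_uniq => /and3P[uP _ uPs].
  have [C [pC cC wC]] := IH [::] isT uPs; exists (P :: C); split=> //=.
  - by rewrite perm_cat2l.
  - move=> c; rewrite inE => /orP[/eqP->|/cC[Q [P' P's ->]]].
      by exists [::]; exists P.
    by exists Q; exists P' => //; rewrite inE P's orbT.
  have wP : cycle_sum e P <= 2 * rho * g%:R.
    have := Prho _ PPs; have := sP _ PPs.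
    case: (P) uP => [|x P'] uP sPg Pr.
      by rewrite /cycle_sum big_nil -sPg mulr0.
    apply: le_trans (cycle_sum_via x uP) _.
    rewrite -sPg -sum1_size natr_sum mulr_sumr big_seq [leRHS]big_seq.
    apply: ler_sum => y yP; rewrite mulr1 ler_wpM2l//.
    by apply: Pr => //; rewrite mem_head.
  rewrite big_cons [in X in _ <= X](natrD _ 1 (size Ps)) mulrDl mul1r.
  by move: wC wP; rewrite big_nil mul0r !add0r; lra.
move=> uall.
have pm : perm_eq ((Q ++ flatten Qs) ++ P ++ flatten Ps)
    ((Q ++ P) ++ flatten Qs ++ flatten Ps).
  by rewrite -!catA perm_cat2l perm_catCA.
have := uall; rewrite (perm_uniq pm) cat_uniq => /and3P[uQP _ uQsPs].
have [C [pC cC wC]] := IH Qs sQ uQsPs; exists ((Q ++ P) :: C); split=> //=.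
- by rewrite perm_sym; apply: perm_trans pm _; rewrite perm_cat2l perm_sym.
- move=> c; rewrite inE => /orP[/eqP->|/cC[Q' [P' P's ->]]].
    by exists Q; exists P.
  by exists Q'; exists P' => //; rewrite inE P's orbT.
have eD x y : e x y <= e p x + e p y by rewrite (e_sym p); exact: e_tri.
have wQP : cycle_sum e (Q ++ P) <= run_cost e (e p) Q + 2 * K * g%:R.
  have EQP : flatten (Q :: [seq [:: x] | x <- P]) = Q ++ P.
    by rewrite /= flatten_seq1.
  rewrite -EQP; apply: le_trans (cycle_sum_flatten eD _) _; first by rewrite EQP.
  rewrite big_cons big_map lerD2l -(sP _ PPs) -sum1_size natr_sum mulr_sumr.
  rewrite big_seq [leRHS]big_seq; apply: ler_sum => y yP; rewrite mulr1 /=.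
  have := PK y; rewrite /= mem_cat yP => /(_ isT); lra.
rewrite !big_cons (natrD _ 1 (size Qs)) (natrD _ 1 (size Ps)).
have : 0 <= 2 * rho * g%:R by rewrite !mulr_ge0.
rewrite !mulrDl !mul1r; lra.
Qed.

Definition close_heads p D x y := e x y <= e p x + e p y - D / 4.

Lemma shortcut_runs p D Qs :
  (forall x1 x2 x3, D <= e p x1 -> D <= e p x2 -> D <= e p x3 ->
    [\/ close_heads p D x1 x2, close_heads p D x1 x3 | close_heads p D x2 x3]) ->
  [::] \notin Qs -> {in flatten Qs, forall x, D <= e p x} ->
  (2 < size Qs)%N ->
  exists2 Qs', perm_eq (flatten Qs') (flatten Qs) &
    \sum_(Q <- Qs') run_cost e (e p) Q <=
    \sum_(Q <- Qs) run_cost e (e p) Q - D / 4.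
Proof.
move=> three Q0 far.
(* Two runs with close heads are merged, the first one reversed. *)
have glue x s y t Qs0 : close_heads p D x y ->
    perm_eq [:: x :: s, y :: t & Qs0] Qs ->
    exists2 Qs', perm_eq (flatten Qs') (flatten Qs) &
    \sum_(Q <- Qs') run_cost e (e p) Q <=
    \sum_(Q <- Qs) run_cost e (e p) Q - D / 4.
  move=> cxy pQ; exists ((rev (x :: s) ++ y :: t) :: Qs0).
    apply: perm_trans (perm_flatten pQ).
    rewrite -[X in perm_eq _ X]/((x :: s) ++ flatten ((y :: t) :: Qs0)).
    by rewrite [X in perm_eq X]/= -catA perm_cat2r perm_rev.
  have <- : \sum_(Q <- [:: x :: s, y :: t & Qs0]) run_cost e (e p) Q =
    \sum_(Q <- Qs) run_cost e (e p) Q by exact: perm_big.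
  rewrite !big_cons run_cost_rev_cat.
  by move: cxy; rewrite /close_heads; lra.
case: Qs Q0 far glue => [|[|x1 s1] [|[|x2 s2] [|[|x3 s3] Qs]]] //.
move=> _ far glue _.
have far1 : D <= e p x1 by apply: far; rewrite /= mem_head.
have far2 : D <= e p x2.
  apply: far; apply/flattenP; exists (x2 :: s2); last exact: mem_head.
  by rewrite !inE eqxx orbT.
have far3 : D <= e p x3.
  apply: far; apply/flattenP; exists (x3 :: s3); last exact: mem_head.
  by rewrite !inE eqxx !orbT.
have [h | h | h] := three _ _ _ far1 far2 far3.
- exact: (glue _ s1 _ s2 ((x3 :: s3) :: Qs) h).
- apply: (glue _ s1 _ s3 ((x2 :: s2) :: Qs) h).
  by rewrite perm_cons (perm_catCA [:: _] [:: _]).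
- apply: (glue _ s2 _ s3 ((x1 :: s1) :: Qs) h).
  by rewrite (perm_catCA [:: _; _] [:: _]).
Qed.

(** [K] is the radius of the gadget about the hub [p], [omega] a lower bound for the gaps between
    clusters, [rho] a bound for their diameters, and [D] the distance from [p] kept by all other
    points of [X]. *)
Record gadget (g m : nat) (K omega rho D : R) (p : T) (X : {pred T}) Ps :=
  Gadget {
    gadget_uniq : uniq (flatten Ps);
    gadget_size : size Ps = m;
    gadget_cluster : {in Ps, forall P, size P = g};
    gadget_near : {in flatten Ps, forall x, e p x <= K};
    gadget_tight : {in Ps, forall P, {in P &, forall x y, e x y <= rho}};
    gadget_apart : forall (P Q : seq T) x y, P \in Ps -> Q \in Ps ->
      x \in P -> y \in Q -> P != Q -> omega <= e x y;
    gadget_sub : {subset flatten Ps <= X};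
    gadget_far : {in X, forall x, x \notin flatten Ps -> D <= e p x}
  }.

Lemma leaving_weight_out Ps x y :
  x \notin flatten Ps -> leaving_weight R Ps x y = 0.
Proof.
move=> xPs; rewrite /leaving_weight big_seq big1// => P PPs.
case xP: (x \in P) => //; case/negP: xPs.
by apply/flattenP; exists P.
Qed.

Lemma leaving_weight_in Ps P x y : uniq (flatten Ps) -> P \in Ps -> x \in P ->
  leaving_weight R Ps x y = (y \notin P)%:R.
Proof.
move=> uPs PPs xP; rewrite /leaving_weight (big_rem P)//= xP /=.
rewrite [X in _ + X]big_seq big1 ?addr0// => Q QPs.
case xQ: (x \in Q) => //=; move: uPs.
rewrite (perm_uniq (perm_flatten (perm_to_rem PPs))) /= cat_uniq.
case/and3P=> _ /hasPn nP _.
have xrem : x \in flatten (rem P Ps) by apply/flattenP; exists Q.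
by have := nP x xrem; rewrite /= xP.
Qed.

(** By the triangle inequality an edge between the gadget and an outer point is at least the outer
    leg minus [K]. An edge leaving the gadget also leaves a cluster, so the charge [omega] is offset
    by taking [b] to be [K + omega]. *)
Lemma gadget_arc g m K omega rho D p X Ps : 0 <= omega ->
  gadget g m K omega rho D p X Ps ->
  {in X &, forall x y, omega * leaving_weight R Ps x y +
    cut_weight e (e p) (mem (flatten Ps)) K (K + omega) x y <= e x y}.
Proof.
move=> om0 G x y xX yX; rewrite /cut_weight /=.
have [xS|xS] := boolP (x \in flatten Ps); last first.
  rewrite leaving_weight_out// mulr0 add0r; case: ifP => // yS.
  have := gadget_near G yS; have := e_tri p y x; rewrite (e_sym y x); lra.
have /flattenP[P PPs xP] := xS.
rewrite (leaving_weight_in _ (gadget_uniq G) PPs xP).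
have [yS|yS] := boolP (y \in flatten Ps).
  rewrite addr0; have /flattenP[Q QPs yQ] := yS.
  have [yP|yP] := boolP (y \in P); rewrite /= ?mulr0 ?mulr1//.
  apply: (gadget_apart G PPs QPs xP yQ); apply: contraNneq yP => ->//.
have -> /= : y \notin P.
  by apply: contra yS => yP; apply/flattenP; exists P.
have := gadget_near G xS; have := e_tri p x y; lra.
Qed.

Lemma gadget_surgery g m K omega rho D delta p X Ps C :
  (2 <= m)%N -> (0 < g)%N -> 0 <= K -> 0 <= omega -> 0 <= rho ->
  delta + 2 * (2 * K + omega + 2 * K * g%:R) + m%:R * (2 * rho * g%:R) <=
    m%:R * omega ->
  delta + (m * g)%:R * (4 * K + omega) <= D / 4 ->
  (forall x1 x2 x3, D <= e p x1 -> D <= e p x2 -> D <= e p x3 ->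
    [\/ close_heads p D x1 x2, close_heads p D x1 x3 | close_heads p D x2 x3]) ->
  gadget g m K omega rho D p X Ps ->
  uniq (flatten C) -> flatten C =i X -> {in C, forall c, (g <= size c)%N} ->
  {in C & Ps, forall c P, ~~ all (mem P) c} ->
  exists C', [/\ perm_eq (flatten C') (flatten C),
    {in C', forall c, (g <= size c)%N},
    {in C', forall c, c \in C \/ has (mem (flatten Ps)) c} &
    \sum_(c <- C') cycle_sum e c <= \sum_(c <- C) cycle_sum e c - delta].
Proof.
move=> m2 g0 K0 om0 rho0 few many three G uC CX gC nall.
have uPs := gadget_uniq G; have sPs := gadget_size G.
have sP := gadget_cluster G.
have sSP : size (flatten Ps) = (m * g)%N.
  by rewrite (size_flatten_const sP) sPs.
have SC : {subset flatten Ps <= flatten C}.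
  by move=> x /(gadget_sub G); rewrite CX.
have P0 P : P \in Ps -> P != [::].
  by move=> /sP; case: P => //= E; rewrite -E in g0.
have [U [Qs [UC US [Q0 sQ] pUQ wUQ]]] :=
  collection_runs e (e p) (mem (flatten Ps)) K (K + omega) uC.
have pS : perm_eq (seq.filter (mem (flatten Ps)) (flatten C)) (flatten Ps).
  apply: uniq_perm => //; first exact: filter_uniq.
  by move=> x; rewrite mem_filter /= andb_idr// => /SC.
have pall : perm_eq (flatten U ++ flatten Qs ++ flatten Ps) (flatten C).
  apply: perm_trans (permEl (perm_filterC (mem (flatten Ps)) (flatten C))).
  by rewrite catA perm_sym perm_catC perm_cat// perm_sym.
have sQ' : (size Qs <= m * g)%N.
  by rewrite (leq_trans sQ)// -sSP -size_filter (perm_size pS).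
have leave : m%:R <= \sum_(c <- C) cycle_sum (leaving_weight R Ps) c.
  rewrite -sPs; apply: leaving_weight_sum => // P PPs; split; first exact: P0.
  by move=> x xP; apply: SC; apply/flattenP; exists P.
(* Sum [gadget_arc] over all arcs: the clusters yield [m] times [omega], and each run loses [K] at
   one end and [K + omega] at the other. *)
have lower : \sum_(c <- U) cycle_sum e c +
    \sum_(Q <- Qs) run_cost e (e p) Q + m%:R * omega <=
    \sum_(c <- C) cycle_sum e c + (size Qs)%:R * (2 * K + omega).
  have : \sum_(c <- C) cycle_sum (fun x y => omega * leaving_weight R Ps x y +
      cut_weight e (e p) (mem (flatten Ps)) K (K + omega) x y) c <=
      \sum_(c <- C) cycle_sum e c.
    rewrite big_seq [leRHS]big_seq; apply: ler_sum => c cC.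
    rewrite /cycle_sum big_seq [leRHS]big_seq; apply: ler_sum => x xc.
    have cX y : y \in c -> y \in X.
      by rewrite -CX => yc; apply/flattenP; exists c.
    by apply: (gadget_arc om0 G); apply: cX => //; rewrite mem_next.
  under eq_bigr => c _ do rewrite cycle_sumD.
  rewrite big_split /= wUQ.
  have -> : \sum_(c <- C) cycle_sum (fun x y => omega * leaving_weight R Ps x y)
      c = omega * \sum_(c <- C) cycle_sum (leaving_weight R Ps) c.
    rewrite mulr_sumr; apply: eq_bigr => c _.
    by rewrite /cycle_sum mulr_sumr.
  have -> : \sum_(Q <- Qs) (run_cost e (e p) Q - K - (K + omega)) =
      \sum_(Q <- Qs) run_cost e (e p) Q - (size Qs)%:R * (2 * K + omega).
    rewrite -sum1_size natr_sum mulr_suml -sumrB; apply: eq_bigr => Q _; lra.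
  have := ler_wpM2l om0 leave; lra.
have hasU P Q : P \in Ps -> has (mem (flatten Ps)) (Q ++ P).
  move=> PPs; rewrite has_cat; apply/orP; right.
  have := P0 _ PPs; case: P PPs => // x P PPs _; apply/hasP; exists x.
    by rewrite mem_head.
  by apply/flattenP; exists (x :: P) => //; rewrite mem_head.
have uall : uniq (flatten U ++ flatten Qs ++ flatten Ps).
  by rewrite (perm_uniq pall).
(* With at most two runs, [2 <= m] leaves a separate cluster for each. *)
have [r2|r3] := leqP (size Qs) 2.
  have uQP : uniq (flatten Qs ++ flatten Ps).
    by move: uall; rewrite cat_uniq => /and3P[].
  have [|V [pV cV wV]] := absorb_runs rho0 sP (gadget_near G)
    (gadget_tight G) _ uQP; first by rewrite sPs (leq_trans r2).
  exists (U ++ V); split.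
  - by rewrite flatten_cat (perm_trans _ pall)// perm_cat2l.
  - move=> c; rewrite mem_cat => /orP[/UC/gC//|/cV[Q [P PPs ->]]].
    by rewrite size_cat (sP _ PPs) leq_addl.
  - move=> c; rewrite mem_cat => /orP[/UC|/cV[Q [P PPs ->]]]; first by left.
    by right; exact: hasU.
  rewrite big_cat /=; move: wV; rewrite sPs => wV.
  have h : (size Qs)%:R * (2 * K + omega + 2 * K * g%:R) <=
      2 * (2 * K + omega + 2 * K * g%:R).
    by rewrite ler_wpM2r ?ler_nat// !(addr_ge0, mulr_ge0).
  lra.
have far : {in flatten Qs, forall x, D <= e p x}.
  move=> x xQ; have : x \in flatten U ++ flatten Qs by rewrite mem_cat xQ orbT.
  rewrite (perm_mem pUQ) mem_filter /= => /andP[xS].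
  by rewrite CX => xX; exact: (gadget_far G).
have [Qs' pQ wQ] := shortcut_runs three Q0 far r3.
(* With at least three runs, the shortened runs and the gadget points, each taken as a run of cost
   at most [2 * K], form one cycle. *)
pose Z := flatten (Qs' ++ [seq [:: x] | x <- flatten Ps]).
have EZ : Z = flatten Qs' ++ flatten Ps by rewrite /Z flatten_cat flatten_seq1.
have pZ : perm_eq Z (flatten Qs ++ flatten Ps) by rewrite EZ perm_cat2r.
have eD x y : e x y <= e p x + e p y by rewrite (e_sym p); exact: e_tri.
have uZ : uniq Z.
  by rewrite (perm_uniq pZ); move: uall; rewrite cat_uniq => /and3P[].
have wZ : cycle_sum e Z <=
    \sum_(Q <- Qs) run_cost e (e p) Q - D / 4 + (m * g)%:R * (2 * K).
  apply: le_trans (cycle_sum_flatten eD uZ) _.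
  rewrite big_cat lerD//= big_map -sSP -sum1_size natr_sum mulr_suml.
  rewrite big_seq [leRHS]big_seq; apply: ler_sum => y yP; rewrite mul1r /=.
  have := gadget_near G yP; lra.
have hasZ : has (mem (flatten Ps)) Z.
  rewrite EZ has_cat; apply/orP; right; case: (flatten Ps) sSP => [|x s _ /=].
    by move=> /= /esym/eqP; rewrite muln_eq0; case: (m) (g) m2 g0 => [|?] [].
  by rewrite mem_head.
exists (rcons U Z); split.
- rewrite -cats1 flatten_cat /= cats0 (perm_trans _ pall)// perm_cat2l//.
- move=> c; rewrite mem_rcons inE => /orP[/eqP->|/UC/gC//].
  rewrite EZ size_cat sSP (leq_trans _ (leq_addl _ _))// leq_pmull//.
  exact: leq_trans m2.
- by move=> c; rewrite mem_rcons inE => /orP[/eqP->|/UC]; [right|left].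
rewrite -cats1 big_cat big_seq1 /=.
(* Every run uses up a gadget point, which bounds the number of runs by [m * g]; the saving of
   [D / 4] pays for all of them. *)
have h : (size Qs)%:R * (2 * K + omega) <= (m * g)%:R * (2 * K + omega).
  by rewrite ler_wpM2r ?ler_nat// !(addr_ge0, mulr_ge0).
have : 0 <= m%:R * omega by rewrite mulr_ge0.
have : 0 <= (m * g)%:R * (2 * K) :> R by rewrite !mulr_ge0.
lra.
Qed.

End Surgery.

(** * Euclidean distance *)

Section Euclidean.
Variables (R : realType) (d : nat).
Implicit Types x y z p : d.-tuple R.

Lemma cauchy_schwarz (a b : 'I_d -> R) :
  (\sum_k a k * b k) ^+ 2 <= (\sum_k a k ^+ 2) * (\sum_k b k ^+ 2).
Proof.
set A := \sum_k a k ^+ 2; set B := \sum_k b k ^+ 2; set c := \sum_k _ * _.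
have B0 : 0 <= B by apply: sumr_ge0 => k _; exact: sqr_ge0.
have : 0 <= \sum_k (B * a k - c * b k) ^+ 2.
  by apply: sumr_ge0 => k _; exact: sqr_ge0.
have -> : \sum_k (B * a k - c * b k) ^+ 2 = B * (A * B - c ^+ 2).
  transitivity (\sum_k (B ^+ 2 * a k ^+ 2 - 2 * B * c * (a k * b k) +
    c ^+ 2 * b k ^+ 2)); first by apply: eq_bigr => k _; ring.
  rewrite big_split /= sumrB -!mulr_sumr -/A -/B -/c; ring.
move: B0; rewrite le_eqVlt => /orP[/eqP B0 _|B0]; last first.
  by rewrite pmulr_rge0// subr_ge0.
suff -> : c = 0 by rewrite -B0 mulr0 expr0n.
rewrite /c big1// => k _; suff -> : b k = 0 by rewrite mulr0.
apply/eqP; rewrite -sqrf_eq0; apply/eqP/le_anti; rewrite sqr_ge0 andbT.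
rewrite [leRHS]B0 /B (bigD1 k)//= lerDl.
by apply: sumr_ge0 => i _; exact: sqr_ge0.
Qed.

Lemma edist_ge0 x y : 0 <= edist x y.
Proof. exact: sqrtr_ge0. Qed.

Lemma sqr_edist x y : edist x y ^+ 2 = \sum_k (tnth x k - tnth y k) ^+ 2.
Proof. by rewrite sqr_sqrtr// sumr_ge0// => k _; exact: sqr_ge0. Qed.

Lemma edistC x y : edist x y = edist y x.
Proof.
by congr Num.sqrt; apply: eq_bigr => k _; rewrite -opprB sqrrN.
Qed.

Lemma edist_triangle x y z : edist x z <= edist x y + edist y z.
Proof.
rewrite -(@ler_pXn2r _ 2)// ?nnegrE ?addr_ge0 ?edist_ge0//.
pose a k := tnth x k - tnth y k; pose b k := tnth y k - tnth z k.
have -> : edist x z ^+ 2 =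
    edist x y ^+ 2 + 2 * (\sum_k a k * b k) + edist y z ^+ 2.
  rewrite !sqr_edist mulr_sumr -!big_split; apply: eq_bigr => k _.
  rewrite /a /b /=; ring.
suff : \sum_k a k * b k <= edist x y * edist y z by rewrite sqrrD; lra.
apply: le_trans (ler_norm _) _.
rewrite -(@ler_pXn2r _ 2)// ?nnegrE ?mulr_ge0 ?edist_ge0//.
by rewrite real_normK ?num_real// exprMn !sqr_edist cauchy_schwarz.
Qed.

Lemma edist_le_l1 x y : edist x y <= \sum_k `|tnth x k - tnth y k|.
Proof.
rewrite -(@ler_pXn2r _ 2)// ?nnegrE ?edist_ge0 ?sumr_ge0//.
rewrite sqr_edist expr2 mulr_suml; apply: ler_sum => k _.
rewrite -real_normK ?num_real// expr2 ler_wpM2l// (bigD1 k)//= lerDl.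
by rewrite sumr_ge0.
Qed.

Lemma coord_le_edist k x y : `|tnth x k - tnth y k| <= edist x y.
Proof.
rewrite -(@ler_pXn2r _ 2)// ?nnegrE ?edist_ge0// real_normK ?num_real//.
rewrite sqr_edist (bigD1 k)//= lerDl.
by apply: sumr_ge0 => i _; exact: sqr_ge0.
Qed.

(* Among three directions two make an angle of at most 120 degrees. *)
Lemma edist_close_heads p D x1 x2 x3 : 0 < D ->
  D <= edist p x1 -> D <= edist p x2 -> D <= edist p x3 ->
  [\/ close_heads (@edist R d) p D x1 x2, close_heads (@edist R d) p D x1 x3 |
      close_heads (@edist R d) p D x2 x3].
Proof.
move=> D0 D1 D2 D3; rewrite /close_heads.
pose a x k := tnth p k - tnth x k; pose c x y := \sum_k a x k * a y k.
(* Failing to save [D / 4] forces the cosine of the angle at [p] below -1/2, because both distances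
   are at least [D]. *)
have obtuse x y : D <= edist p x -> D <= edist p y ->
    edist p x + edist p y - D / 4 < edist x y ->
    c x y < - (edist p x * edist p y / 2).
  move=> Dx Dy lt_xy.
  have : (edist p x + edist p y - D / 4) ^+ 2 < edist x y ^+ 2.
    by rewrite ltr_pXn2r// nnegrE ?edist_ge0//; lra.
  have -> : edist x y ^+ 2 = edist p x ^+ 2 + edist p y ^+ 2 - 2 * c x y.
    rewrite !sqr_edist mulr_sumr -big_split -sumrB; apply: eq_bigr => k _.
    rewrite /a /=; ring.
  have : D * edist p y <= edist p x * edist p y.
    by rewrite ler_wpM2r// edist_ge0.
  have : D * edist p x <= edist p x * edist p y.
    by rewrite mulrC ler_wpM2l// edist_ge0.
  have := sqr_ge0 D; nra.
have [|h12] := leP (edist x1 x2) _; first by constructor 1.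
have [|h13] := leP (edist x1 x3) _; first by constructor 2.
have [|h23] := leP (edist x2 x3) _; first by constructor 3.
have {}h12 := obtuse _ _ D1 D2 h12; have {}h13 := obtuse _ _ D1 D3 h13.
have {}h23 := obtuse _ _ D2 D3 h23.
set d1 := edist p x1 in D1 h12 h13; set d2 := edist p x2 in D2 h12 h23.
set d3 := edist p x3 in D3 h13 h23.
(* The squared norm of the sum of the three unit vectors, scaled by the product of the distances.
   Three cosines below -1/2 would make it negative. *)
have : 0 <= \sum_k (d2 * d3 * a x1 k + d1 * d3 * a x2 k + d1 * d2 * a x3 k) ^+ 2.
  by apply: sumr_ge0 => k _; exact: sqr_ge0.
have -> : \sum_k (d2 * d3 * a x1 k + d1 * d3 * a x2 k + d1 * d2 * a x3 k) ^+ 2 =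
    3 * (d1 * d2 * d3) ^+ 2 + 2 * (d3 ^+ 2 * (d1 * d2) * c x1 x2) +
    2 * (d2 ^+ 2 * (d1 * d3) * c x1 x3) + 2 * (d1 ^+ 2 * (d2 * d3) * c x2 x3).
  transitivity (\sum_k ((d2 * d3) ^+ 2 * a x1 k ^+ 2 +
     (d1 * d3) ^+ 2 * a x2 k ^+ 2 + (d1 * d2) ^+ 2 * a x3 k ^+ 2 +
     2 * (d3 ^+ 2 * (d1 * d2)) * (a x1 k * a x2 k) +
     2 * (d2 ^+ 2 * (d1 * d3)) * (a x1 k * a x3 k) +
     2 * (d1 ^+ 2 * (d2 * d3)) * (a x2 k * a x3 k))).
    by apply: eq_bigr => k _; ring.
  rewrite !big_split /= -!mulr_sumr.
  rewrite -!sqr_edist -/d1 -/d2 -/d3 -/(c _ _) -/(c _ _) -/(c _ _); ring.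
have scale (u v w c0 : R) : 0 < u -> 0 < v -> 0 < w -> c0 < - (u * v / 2) ->
    w ^+ 2 * (u * v) * c0 < - ((u * v * w) ^+ 2 / 2).
  move=> u0 v0 w0 lt_c.
  have -> : - ((u * v * w) ^+ 2 / 2) = w ^+ 2 * (u * v) * - (u * v / 2) by field.
  by rewrite ltr_pM2l// !mulr_gt0// exprn_gt0.
have d10 : 0 < d1 by lra.
have d20 : 0 < d2 by lra.
have d30 : 0 < d3 by lra.
have := scale _ _ _ _ d10 d20 d30 h12; have := scale _ _ _ _ d10 d30 d20 h13.
have := scale _ _ _ _ d20 d30 d10 h23.
have -> : d2 * d3 * d1 = d1 * d2 * d3 by ring.
have -> : d1 * d3 * d2 = d1 * d2 * d3 by ring.
lra.
Qed.

End Euclidean.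

(** * Surgery at many gadgets and the resulting gap in [TF] *)

Section Separation.
Variables (R : realType) (d : nat).
Notation point := (d.-tuple R).
Variables (g m : nat) (K omega rho D delta : R).
Hypotheses (m2 : (2 <= m)%N) (g0 : (0 < g)%N).
Hypotheses (K0 : 0 <= K) (om0 : 0 <= omega) (rho0 : 0 <= rho) (D0 : 0 < D).
Hypothesis few :
  delta + 2 * (2 * K + omega + 2 * K * g%:R) + m%:R * (2 * rho * g%:R) <=
  m%:R * omega.
Hypothesis many : delta + (m * g)%:R * (4 * K + omega) <= D / 4.

Definition gadget_in (X : {pred point}) (Ps : seq (seq point)) :=
  exists p, gadget (@edist R d) g m K omega rho D p X Ps.

Lemma gadgets_surgery (X : {pred point}) (Gs : seq (seq (seq point))) C :
  {in Gs, forall Ps, gadget_in X Ps} -> uniq (flatten (map flatten Gs)) ->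
  uniq (flatten C) -> flatten C =i X -> {in C, forall c, (g <= size c)%N} ->
  (forall (c P : seq point) Ps, c \in C -> Ps \in Gs -> P \in Ps ->
    ~~ all (mem P) c) ->
  exists C', [/\ perm_eq (flatten C') (flatten C),
    {in C', forall c, (g <= size c)%N} &
    collection_length C' <= collection_length C - (size Gs)%:R * delta].
Proof.
elim: Gs C => [|Ps Gs IH] C GX /= uG uC CX gC nall.
  by exists C; split=> //; rewrite mul0r subr0.
have [p G] : gadget_in X Ps by apply: GX; rewrite mem_head.
move: uG; rewrite cat_uniq => /and3P[_ /hasPn disj uG].
have [||C1 [p1 gC1 hC1 w1]] := gadget_surgery (@edist_ge0 R d) (@edistC R d)
  (@edist_triangle R d) m2 g0 K0 om0 rho0 few many _ G uC CX gC.
- by move=> x1 x2 x3; exact: edist_close_heads.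
- by move=> c P cC PPs; apply: (nall _ _ Ps) => //; rewrite mem_head.
have [||||||C2 [p2 gC2 w2]] := IH C1.
- by move=> Ps' Ps's; apply: GX; rewrite inE Ps's orbT.
- exact: uG.
- by rewrite (perm_uniq p1).
- by move=> x; rewrite (perm_mem p1) CX.
- exact: gC1.
(* A new cycle contains a point of the gadget just treated, which is disjoint from the other
   gadgets, so it lies in none of their clusters. *)
- move=> c P Ps' cC1 Ps's PPs'; case: (hC1 c cC1) => [cC|/hasP[x xc /= xPs]].
    by apply: (nall _ _ Ps') => //; rewrite inE Ps's orbT.
  apply/negP => /allP/(_ x xc) /= xP.
  have : x \in flatten (map flatten Gs).
    apply/flattenP; exists (flatten Ps'); first exact: map_f.
    by apply/flattenP; exists P.
  by move/disj; rewrite /= xPs.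
exists C2; split=> //; first exact: perm_trans p2 p1.
apply: le_trans w2 _; rewrite (natrD _ 1 (size Gs)) mulrDl mul1r.
by move: w1; rewrite /collection_length /cycle_length /cycle_sum; lra.
Qed.

(** A cycle with more than [g] vertices cannot lie in a cluster of [g] points, so the surgery
    applies to every competitor for [TF g.+1] and yields one for [TF g]. *)
Lemma TF_separation (X : {fset point}) (Gs : seq (seq (seq point))) :
  (3 <= g)%N -> {in Gs, forall Ps, gadget_in [in X] Ps} ->
  uniq (flatten (map flatten Gs)) -> (0 < size Gs)%N ->
  TF g X + (size Gs)%:R * delta <= TF g.+1 X.
Proof.
move=> g3 GX uG G0.
(* One gadget already has at least [2 * g] points. This puts the covering requirement for [g.+1] in
   force and makes a Hamilton cycle feasible, so that the infimum is over a nonempty set. *)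
have gX : (g < #|` X|)%N.
  case: Gs G0 GX uG => // Ps Gs _ GX _.
  have [p G] : gadget_in [in X] Ps by apply: GX; rewrite mem_head.
  have sS : size (flatten Ps) = (m * g)%N.
    by rewrite (size_flatten_const (gadget_cluster G)) (gadget_size G).
  have := uniq_leq_size (gadget_uniq G) (gadget_sub G : {subset _ <= X}).
  rewrite sS => /(leq_trans _); apply.
  by apply: (@leq_trans (2 * g)); [lia|rewrite leq_mul2r m2 orbT].
have len_ge0 C : 0 <= collection_length C :> R.
  apply: sumr_ge0 => c _; apply: sumr_ge0 => x _; exact: edist_ge0.
apply: lb_le_inf.
  exists (collection_length [:: enum_fset X]), [:: enum_fset X] => //.
  have EX : flatten [:: enum_fset X] = enum_fset X by rewrite /= cats0.
  split=> [|c|_ x xX]; last by rewrite EX.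
    split=> [c||x]; rewrite ?EX ?fset_uniq// inE => /eqP->.
    by rewrite (leq_trans g3)// ltnW.
  by rewrite inE => /eqP->.
move=> _ [C [[C3 uC subC] gC covC] <-].
have CX : flatten C =i [in X].
  by move=> x; apply/idP/idP; [exact: subC|exact: covC].
have [||C' [pC gC' wC]] := gadgets_surgery GX uG uC CX.
- by move=> c /gC /ltnW.
- move=> c P Ps cC PsG PPs; apply/negP => /allP sub.
  have [p G] := GX _ PsG.
  have := uniq_leq_size (uniq_flatten_mem uC cC) sub.
  by rewrite (gadget_cluster G PPs) leqNgt gC.
suff : TF g X <= collection_length C' by move: wC; lra.
apply: ge_inf; first by exists 0 => _ [C0 _ <-].
exists C' => //; split=> //; first split=> //.
- by move=> c /gC' /(leq_trans g3).
- by rewrite (perm_uniq pC).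
- by move=> x; rewrite (perm_mem pC); exact: subC.
- by move=> _ x xX; rewrite (perm_mem pC) CX.
Qed.

End Separation.

(** * Geometry of the gadgets *)

(* Integer lengths in units of the mesh: the clusters are [A] apart in a [k] by
   [k] square array, and the centre of a cell is [H] away from its walls.  The
   last two fields make the surgery profitable for at most two runs and for at
   least three runs respectively. *)
Record gadget_scales (d g A k H : nat) : Prop := GadgetScales {
  scale_gap : (2 * g + 1 < A)%N;
  scale_side : (1 < k)%N;
  scale_fit : (A * k <= H)%N;
  scale_few : (2 + 8 * d * A * k + 2 * A + 8 * d * A * k * g +
    4 * (k * k) * d * g * g <= k * k * A)%N;
  scale_many : (4 * (1 + k * k * g * (4 * d * A * k + A)) <= H)%N
}.

(** [A] makes the intra-cluster term exactly half of [k * k * A]; then [k] is so large that the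
    terms linear in [k] fit in the other half; [H] comes last. *)
Lemma gadget_scales_exist d g : (0 < d)%N -> (0 < g)%N ->
  exists A k H, gadget_scales d g A k H.
Proof.
move=> d0 g0; pose A := (8 * d * g * g)%N; pose k := (32 * d * (g + 1))%N.
exists A, k, (4 * (1 + k * k * g * (4 * d * A * k + A)) + A * k)%N.
have A0 : (2 * g + 1 < A)%N by rewrite /A; nia.
have k0 : (1 < k)%N by rewrite /k; nia.
split=> //; [exact: leq_addl| |exact: leq_addr].
have -> : (4 * (k * k) * d * g * g = k * k * (4 * d * g * g))%N by lia.
have : (32 * d * (g + 1) * k * A <= k * k * A)%N by rewrite /k; lia.
have : (2 * (k * k * (4 * d * g * g)) = k * k * A)%N by rewrite /A; lia.
have : (2 <= A)%N by lia.
have : (A <= d * (g + 1) * k * A)%N by rewrite leq_pmull// !muln_gt0; lia.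
have -> : (8 * d * A * k * g = 8 * (d * g * k * A))%N by lia.
have -> : (8 * d * A * k = 8 * (d * k * A))%N by lia.
have -> : (32 * d * (g + 1) * k * A = 32 * (d * (g + 1) * k * A))%N by lia.
have -> : (d * (g + 1) * k * A = d * g * k * A + d * k * A)%N by lia.
lia.
Qed.

Section GadgetGeometry.
Variables (R : realType) (d g k A H q : nat).
Notation point := (d.-tuple R).

(** A cell has side [1 / q], that is [2 * H] meshes. *)
Definition mesh : R := (q * (2 * H))%:R^-1.

Definition label : finType := ('I_k * 'I_k * 'I_g)%type.

(** Offset from the centre of the cell, in meshes. The array of clusters spans the first two axes,
    and a cluster occupies [g] consecutive boxes along the first. *)
Definition label_coord (l : label) (i : 'I_d) : nat :=
  if val i == 0%N then (A * l.1.1 + l.2)%N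
  else if val i == 1%N then (A * l.1.2)%N else 0%N.

Definition grid_box (j : {ffun 'I_d -> 'I_q}) (l : label) (i : 'I_d) : set R :=
  `[(2 * H * j i + H + label_coord l i)%:R * mesh,
    (2 * H * j i + H + label_coord l i + 1)%:R * mesh[%classic.

Definition grid_cell (j : {ffun 'I_d -> 'I_q}) (i : 'I_d) : set R :=
  `[(2 * H * j i)%:R * mesh, (2 * H * (j i).+1)%:R * mesh[%classic.

Definition box j l : set point := [set x | forall i, grid_box j l i (tnth x i)].
Definition cell j : set point := [set x | forall i, grid_cell j i (tnth x i)].

Hypotheses (d2 : (2 <= d)%N) (g0 : (0 < g)%N) (q0 : (0 < q)%N).
Hypothesis scales : gadget_scales d g A k H.
Let gA := scale_gap scales.
Let k1 := scale_side scales.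
Let AkH := scale_fit scales.

Lemma H_gt0 : (0 < H)%N.
Proof. by apply: leq_trans AkH; rewrite muln_gt0; lia. Qed.

Lemma mesh_gt0 : 0 < mesh.
Proof. by rewrite invr_gt0 ltr0n !muln_gt0 q0 H_gt0. Qed.

Lemma grid_boxP j l i x : grid_box j l i x <->
  (2 * H * j i + H + label_coord l i)%:R * mesh <= x <
  (2 * H * j i + H + label_coord l i)%:R * mesh + mesh.
Proof. by rewrite /grid_box /= in_itv /= (natrD _ _ 1) mulrDl mul1r. Qed.

Lemma label_coord_lt l i : (label_coord l i < A * k)%N.
Proof.
case: l => [[a b] t]; rewrite /label_coord /=.
have := ltn_ord a; have := ltn_ord b; have := ltn_ord t => tg bk ak.
have : (A * a + A <= A * k)%N by rewrite addnC -mulnS leq_mul2l ak orbT.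
have : (A * b + A <= A * k)%N by rewrite addnC -mulnS leq_mul2l bk orbT.
by case: ifP => _; [lia|case: ifP => _; lia].
Qed.

Lemma box_sub_cell j l : box j l `<=` cell j.
Proof.
move=> x bx i; have /grid_boxP := bx i; rewrite /grid_cell /= in_itv /=.
have v0 := mesh_gt0; have zl := leq_trans (label_coord_lt l i) AkH.
have : (2 * H * j i)%:R * mesh <=
    (2 * H * j i + H + label_coord l i)%:R * mesh.
  by rewrite ler_pM2r// ler_nat; lia.
have : (2 * H * j i + H + label_coord l i)%:R * mesh + mesh <=
    (2 * H * (j i).+1)%:R * mesh.
  by rewrite -[X in _ + X]mul1r -mulrDl -(natrD _ _ 1) ler_pM2r// ler_nat; lia.
lra.
Qed.

Lemma lt_mesh (a b : nat) x : a%:R * mesh <= x -> x < b%:R * mesh -> (a < b)%N.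
Proof. by move=> ax /(le_lt_trans ax); rewrite ltr_pM2r ?mesh_gt0// ltr_nat. Qed.

Lemma grid_cell_inj j j' x : cell j x -> cell j' x -> j = j'.
Proof.
move=> cx cx'; apply/ffunP => i; apply/val_inj => /=.
have := cx i; have := cx' i; rewrite /grid_cell /= !in_itv /=.
move=> /andP[a1 b1] /andP[a2 b2].
have := lt_mesh a1 b2; have := lt_mesh a2 b1; have := H_gt0; nia.
Qed.

(** Since [g < A], the offset [A * a + t] determines [a] and [t]. *)
Lemma box_inj j l l' x : box j l x -> box j l' x -> l = l'.
Proof.
move=> bx bx'; have same i : label_coord l i = label_coord l' i.
  have := bx i; have := bx' i; rewrite /grid_box /= !in_itv /=.
  move=> /andP[a1 b1] /andP[a2 b2].
  have := lt_mesh a1 b2; have := lt_mesh a2 b1; lia.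
have d0 : (0 < d)%N by lia.
have := same (Ordinal d0); have := same (Ordinal (d2 : (1 < d)%N)).
rewrite /label_coord /=; case: l l' {bx bx' same} => [[a b] t] [[a' b'] t'] /=.
have := ltn_ord t; have := ltn_ord t' => t'g tg Eb Ea.
have Ebb : b = b' by apply/val_inj => /=; nia.
have Eaa : a = a' by apply/val_inj => /=; nia.
by rewrite Eaa Ebb; congr (_, _, _); apply/val_inj => /=; rewrite Eaa in Ea; lia.
Qed.

Definition clusters (pt : label -> point) : seq (seq point) :=
  [seq [seq pt (ab, t) | t <- enum 'I_g] | ab <- enum [set: 'I_k * 'I_k]%SET].

Lemma clustersP pt P : reflect (exists ab, P = [seq pt (ab, t) | t <- enum 'I_g])
  (P \in clusters pt).
Proof.
apply: (iffP mapP) => [[ab _ ->]|[ab ->]]; first by exists ab.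
by exists ab => //; rewrite mem_enum inE.
Qed.

Lemma mem_clusters pt x :
  reflect (exists l, x = pt l) (x \in flatten (clusters pt)).
Proof.
apply: (iffP flattenP) => [[P /clustersP[ab ->] /mapP[t _ ->]]|[[ab t] ->]].
  by exists (ab, t).
exists [seq pt (ab, t) | t <- enum 'I_g]; first by apply/clustersP; exists ab.
by apply: map_f; rewrite mem_enum.
Qed.

Lemma clusters_gadget j (pt : label -> point) (X : {pred point}) :
  (forall l, box j l (pt l)) -> (forall l, pt l \in X) ->
  {in X, forall x, (exists l, x = pt l) \/ ~ cell j x} ->
  gadget_in g (k * k) (d%:R * A%:R * k%:R * mesh) (A%:R / 2 * mesh)
    (d%:R * g%:R * mesh) (H%:R * mesh) X (clusters pt).
Proof.
move=> bpt ptX Xcell; have v0 := mesh_gt0.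
pose p : point := [tuple (2 * H * j i + H)%:R * mesh | i < d].
(* Relative to the centre [p], each coordinate is the offset of the label plus less than one
   mesh. *)
have bptP l i :
    0 <= tnth (pt l) i - tnth p i - (label_coord l i)%:R * mesh < mesh.
  have /grid_boxP := bpt l i; rewrite tnth_mktuple (natrD _ _ (label_coord l i)).
  by rewrite mulrDl; lra.
exists p; split.
- rewrite -[flatten _]/(allpairs (fun ab t => pt (ab, t)) _ _).
  apply: allpairs_uniq; rewrite ?enum_uniq// => -[ab t] [ab' t'] _ _ /= E.
  by apply: (box_inj (bpt (ab, t))); rewrite E; exact: bpt.
- by rewrite size_map -cardE cardsT card_prod !card_ord.
- by move=> P /clustersP[ab ->]; rewrite size_map -cardE card_ord.
- move=> _ /mem_clusters[l ->]; apply: le_trans (edist_le_l1 _ _) _.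
  apply: (@le_trans _ _ (\sum_(i < d) A%:R * k%:R * mesh)); last first.
    by rewrite sumr_const card_ord -[leLHS]mulr_natl !mulrA.
  apply: ler_sum => i _; have := bptP l i.
  have : (label_coord l i)%:R * mesh + mesh <= A%:R * k%:R * mesh.
    rewrite -[X in _ + X]mul1r -mulrDl -(natrD _ _ 1) -natrM ler_pM2r// ler_nat.
    by rewrite addn1 label_coord_lt.
  have : 0 <= (label_coord l i)%:R * mesh by rewrite mulr_ge0// ltW.
  by rewrite ler_norml; lra.
- move=> _ /clustersP[ab ->] _ _ /mapP[t _ ->] /mapP[t' _ ->].
  apply: le_trans (edist_le_l1 _ _) _.
  apply: (@le_trans _ _ (\sum_(i < d) g%:R * mesh)); last first.
    by rewrite sumr_const card_ord -[leLHS]mulr_natl !mulrA.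
  apply: ler_sum => i _; have := bptP (ab, t) i; have := bptP (ab, t') i.
  have close (u u' : 'I_g) : (label_coord (ab, u) i)%:R * mesh + mesh <=
      (label_coord (ab, u') i)%:R * mesh + g%:R * mesh.
    rewrite -[X in _ + X]mul1r -!mulrDl -(natrD _ _ 1) -natrD ler_pM2r// ler_nat.
    rewrite /label_coord /=; have := ltn_ord u.
    by case: ifP => _; [lia|case: ifP => _; lia].
  have := close t t'; have := close t' t; rewrite ler_norml; lra.
- move=> _ _ x y /clustersP[ab ->] /clustersP[ab' ->].
  move=> /mapP[t _ ->] /mapP[t' _ ->].
  move=> neq; have {}neq : ab != ab' by apply: contraNneq neq => ->.
  (* Offsets at least [A - g] meshes apart give points at least [A - g - 1] meshes apart, which is
     at least [A / 2] by [scale_gap]. *)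
  suff [i far] : exists i : 'I_d,
      (label_coord (ab, t) i + A <= label_coord (ab', t') i + g)%N \/
      (label_coord (ab', t') i + A <= label_coord (ab, t) i + g)%N.
    apply: le_trans (coord_le_edist i _ _).
    have b1 := bptP (ab, t) i; have b2 := bptP (ab', t') i.
    have gA' : 2 * g%:R * mesh + 2 * mesh <= A%:R * mesh.
      have : (2 * g + 2 <= A)%N by lia.
      by rewrite -(ler_nat R) natrD natrM => /(ler_wpM2r (ltW v0)); lra.
    have far' (a b : nat) : (a + A <= b + g)%N ->
        a%:R * mesh + A%:R * mesh <= b%:R * mesh + g%:R * mesh.
      by move=> h; rewrite -!mulrDl -!natrD ler_pM2r// ler_nat.
    case: far => /far' far.
      by rewrite ler_normr; apply/orP; right; lra.
    by rewrite ler_normr; apply/orP; left; lra.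
  have d0 : (0 < d)%N by lia.
  case: ab ab' neq => [a b] [a' b'] neq.
  have tg := ltn_ord t; have tg' := ltn_ord t'.
  case: (ltngtP a a') => [aa|aa|/val_inj aa].
  + exists (Ordinal d0); rewrite /label_coord /=; nia.
  + exists (Ordinal d0); rewrite /label_coord /=; nia.
  exists (Ordinal (d2 : (1 < d)%N)); rewrite /label_coord /=.
  case: (ltngtP b b') => [bb|bb|/val_inj bb]; [nia|nia|].
  by move: neq; rewrite aa bb eqxx.
- by move=> x /mem_clusters[l ->].
- move=> x xX xS; case: (Xcell _ xX) => [[l El]|ncell].
    by case/negP: xS; apply/mem_clusters; exists l.
  have [i xi] : exists i, ~ grid_cell j i (tnth x i).
    by apply/existsNP.
  apply: le_trans (coord_le_edist i _ _); rewrite tnth_mktuple.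
  move: xi; rewrite /grid_cell /= in_itv /= => /negP.
  rewrite negb_and -!real_ltNge ?num_real// -leNgt.
  have -> : (2 * H * (j i).+1)%:R * mesh =
      (2 * H * j i)%:R * mesh + H%:R * mesh + H%:R * mesh.
    by rewrite -!mulrDl -!natrD; congr (_%:R * _); lia.
  rewrite natrD mulrDl => /orP[h|h].
    by rewrite ler_normr; apply/orP; left; lra.
  by rewrite ler_normr; apply/orP; right; lra.
Qed.

Lemma gadget_few :
  mesh + 2 * (2 * (d%:R * A%:R * k%:R * mesh) + A%:R / 2 * mesh +
    2 * (d%:R * A%:R * k%:R * mesh) * g%:R) +
    (k * k)%:R * (2 * (d%:R * g%:R * mesh) * g%:R) <=
  (k * k)%:R * (A%:R / 2 * mesh).
Proof.
have := scale_few scales; rewrite -(ler_nat R) !(natrM, natrD).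
move=> /(ler_wpM2r (ltW mesh_gt0)).
lra.
Qed.

Lemma gadget_many :
  mesh + (k * k * g)%:R *
    (4 * (d%:R * A%:R * k%:R * mesh) + A%:R / 2 * mesh) <= H%:R * mesh / 4.
Proof.
have := scale_many scales; rewrite -(ler_nat R) !(natrM, natrD).
move=> /(ler_wpM2r (ltW mesh_gt0)).
have : 0 <= k%:R * k%:R * g%:R * A%:R * mesh :> R.
  by rewrite !mulr_ge0// ltW ?mesh_gt0.
lra.
Qed.

Lemma TF_gadgets (X : {fset point}) (J : seq {ffun 'I_d -> 'I_q})
    (pt : {ffun 'I_d -> 'I_q} -> label -> point) :
  (3 <= g)%N -> uniq J -> (0 < size J)%N ->
  {in J, forall j, forall l, box j l (pt j l) /\ pt j l \in X} ->
  {in J, forall j, {in X, forall x, (exists l, x = pt j l) \/ ~ cell j x}} ->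
  TF g X + (size J)%:R * mesh <= TF g.+1 X.
Proof.
move=> g3 uJ J0 bX cX; have v0 := ltW mesh_gt0.
have -> : size J = size [seq clusters (pt j) | j <- J] by rewrite size_map.
apply: (@TF_separation R d g (k * k) (d%:R * A%:R * k%:R * mesh)
  (A%:R / 2 * mesh) (d%:R * g%:R * mesh) (H%:R * mesh)); rewrite ?size_map//.
- by apply: (@leq_trans (2 * 2)) => //; exact: leq_mul.
- by rewrite !mulr_ge0.
- by rewrite !mulr_ge0.
- by rewrite !mulr_ge0.
- by rewrite mulr_gt0 ?mesh_gt0// ltr0n H_gt0.
- exact: gadget_few.
- exact: gadget_many.
- move=> _ /mapP[j jJ ->]; apply: (@clusters_gadget j).
  + by move=> l; case: (bX j jJ l).
  + by move=> l; case: (bX j jJ l).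
  + exact: cX.
have sub j x : j \in J -> x \in flatten (clusters (pt j)) -> cell j x.
  by move=> jJ /mem_clusters[l ->]; apply: (@box_sub_cell j l); case: (bX j jJ l).
elim: J uJ {J0} bX cX sub => //= j J IH /andP[jJ uJ] bX cX sub.
rewrite cat_uniq IH ?andbT//; last first.
- by move=> j' x j'J; apply: sub; rewrite inE j'J orbT.
- by move=> j' j'J; apply: cX; rewrite inE j'J orbT.
- by move=> j' j'J; apply: bX; rewrite inE j'J orbT.
have jJ' : j \in j :: J by rewrite mem_head.
apply/andP; split.
  have [||p G] := @clusters_gadget j (pt j) [in X] _ _ (cX j jJ').
  + by move=> l; case: (bX j jJ' l).
  + by move=> l; case: (bX j jJ' l).
  exact: gadget_uniq G.
apply/hasPn => x /flattenP[_ /mapP[_ /mapP[j' j'J ->] ->] xj'].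
apply: contraNN jJ => /= xj.
have cj := sub _ _ jJ' xj.
have j'J' : j' \in j :: J by rewrite inE j'J orbT.
by rewrite (grid_cell_inj cj (sub _ _ j'J' xj')).
Qed.

End GadgetGeometry.

(** * Expected number of gadgets *)

Lemma uniform_prob_itvco (R : realType) (a b : R) : 0 <= a -> a < b -> b <= 1 ->
  uniform_prob (@ltr01 R) `[a, b[ = (b - a)%:E.
Proof.
move=> a0 ab b1; rewrite /uniform_prob (eq_integral (fun=> 1%:E)).
  by rewrite integral_cst//= lebesgue_measure_itv/= lte_fin ab mul1e EFinB.
move=> x; rewrite inE /= in_itv /= => /andP[ax xb].
rewrite /uniform_pdf ifT ?subr0 ?invr1//.
by rewrite (le_trans a0 ax) (le_trans (ltW xb) b1).
Qed.

(** The inverse of [1 - 1/n] is [1 + 1/(n-1)], at most [exp(1/(n-1))], and [n/(n-1)] is at most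
    2. *)
Lemma exp_neg2_le (R : realType) (n : nat) : (2 <= n)%N ->
  expR (- 2) <= (1 - n%:R^-1) ^+ n :> R.
Proof.
move=> n2; have n1 : 0 < n%:R - 1 :> R by rewrite subr_gt0 ltr1n.
have n0 : 0 < n%:R :> R by rewrite ltr0n; lia.
have -> : 1 - n%:R^-1 = (n%:R / (n%:R - 1))^-1 :> R.
  by field; rewrite !gt_eqF.
rewrite exprVn expRN lef_pV2 ?posrE ?expR_gt0 ?exprn_gt0 ?divr_gt0//.
apply: (@le_trans _ _ (expR (n%:R - 1)^-1 ^+ n)).
  have n0' : (0 < n)%N by lia.
  have r0 : 0 <= n%:R / (n%:R - 1) :> R by apply: divr_ge0; apply: ltW.
  rewrite (ler_pXn2r n0') ?nnegrE ?expR_ge0//.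
  apply: le_trans (expR_ge1Dx _).
  by rewrite le_eqVlt; apply/orP; left; apply/eqP; field; rewrite gt_eqF.
rewrite -expRM_natl ler_expR -[leLHS]/(_ * _^-1) ler_pdivrMr//.
have : 2 <= n%:R :> R by rewrite ler_nat.
lra.
Qed.

Lemma ffact_ge (n m : nat) : ((n - m) ^ m <= n ^_ m)%N.
Proof.
elim: m => // m IH; rewrite ffactnSr expnSr leq_mul ?leq_sub2l//.
apply: leq_trans IH; case: m => // m.
by rewrite leq_exp2r// leq_sub2l.
Qed.

Section GadgetEvents.
Variables (R : realType) (d g k A H q : nat).
Notation point := (d.-tuple R).
Notation cells := {ffun 'I_d -> 'I_q}.
Notation labels := (label g k).
Notation gbox := (@box R d g k A H q).
Notation gcell := (@cell R d H q).
Notation placement := {ffun labels -> 'I_(q ^ d)}.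
Hypotheses (d2 : (2 <= d)%N) (g0 : (0 < g)%N) (q2 : (2 <= q)%N).
Hypothesis scales : gadget_scales d g A k H.
Let q0 : (0 < q)%N := ltnW q2.
Let n2 : (2 <= q ^ d)%N.
Proof. by apply: leq_trans (leq_pexp2l q0 (ltnW d2)); rewrite expn1. Qed.

(** A placement assigns a sample index to each box; all other sample points must avoid the cell. *)
Definition target (j : cells) (s : placement) (i : nat) : set point :=
  if [pick l | val (s l) == i] is Some l then gbox j l
  else ~` gcell j.

Lemma target_in j (s : placement) l : injective s ->
  target j s (s l) = gbox j l.
Proof.
move=> inj_s; rewrite /target; case: pickP => [l' /eqP/val_inj/inj_s ->//|].
by move/(_ l); rewrite eqxx.
Qed.

Lemma target_cases j (s : placement) i x : target j s i x ->
  (exists2 l, i = s l & gbox j l x) \/ ~ gcell j x.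
Proof.
rewrite /target; case: pickP => [l /eqP <-|_] h; last by right.
by left; exists l.
Qed.

Lemma measurable_coordinates (B : 'I_d -> set R) :
  (forall i, measurable (B i)) ->
  measurable [set x : point | forall i, B i (tnth x i)].
Proof.
move=> mB.
have -> : [set x : point | forall i, B i (tnth x i)] =
    \bigcap_(i in [set: 'I_d]) ((fun x : point => tnth x i) @^-1` B i).
  by apply/seteqP; split => x /= h i; [move=> _|]; exact: h.
apply: fin_bigcap_measurable; first exact: finite_finset.
move=> i _; rewrite -[X in measurable X]setTI.
exact: measurable_tnth.
Qed.

Lemma measurable_box j l : measurable (gbox j l).
Proof. by apply: measurable_coordinates => i; exact: measurable_itv. Qed.

Lemma measurable_cell j : measurable (gcell j).
Proof. by apply: measurable_coordinates => i; exact: measurable_itv. Qed.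

Lemma measurable_target j s i : measurable (target j s i).
Proof.
rewrite /target; case: pickP => [l _|_]; first exact: measurable_box.
by apply: measurableC; exact: measurable_cell.
Qed.

Variables (disp : measure_display) (T : measurableType disp).
Variables (P : probability T R) (X : nat -> {RV P >-> point}).
Hypothesis X_uniform : forall i, uniform_cube (X i).
Hypothesis X_independent : independent_RVs X.

Let v0 : 0 < mesh R H q := mesh_gt0 R d2 g0 q0 scales.

Lemma grid_sub01 (a b : nat) : (a < b)%N -> (b <= q * (2 * H))%N ->
  uniform_prob (@ltr01 R) `[a%:R * mesh R H q, b%:R * mesh R H q[ =
  ((b%:R - a%:R) * mesh R H q)%:E.
Proof.
move=> ab bq; rewrite uniform_prob_itvco ?mulrBl//.
- by rewrite mulr_ge0// ltW.
- by rewrite ltr_pM2r// ltr_nat.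
have v0' := v0; rewrite /mesh invr_gt0 in v0'.
by rewrite ler_pdivrMr// mul1r ler_nat.
Qed.

Lemma prob_box i j l : P (X i @^-1` gbox j l) = (mesh R H q ^+ d)%:E.
Proof.
rewrite -[LHS]/(distribution P (X i) _) X_uniform; last first.
  by move=> m; exact: measurable_itv.
rewrite (eq_bigr (fun=> (mesh R H q)%:E)) => [|m _].
  by rewrite prodEFin prodr_const card_ord.
rewrite grid_sub01 ?addn1//; first by rewrite -natrB// subSnn mul1r.
have := scale_fit scales.
have := label_coord_lt d2 g0 q0 scales l m; have := ltn_ord (j m); nia.
Qed.

Lemma prob_outside_cell i j :
  P (X i @^-1` (~` gcell j)) = (1 - (q ^ d)%:R^-1)%:E.
Proof.
rewrite -preimage_setC probability_setC; last first.
  by rewrite -[X in measurable X]setTI; apply: measurable_funPT => //;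
     exact: measurable_cell.
rewrite -[P _]/(distribution P (X i) _) X_uniform; last first.
  by move=> m; exact: measurable_itv.
rewrite (eq_bigr (fun=> (q%:R^-1)%:E)) => [|m _].
  by rewrite prodEFin prodr_const card_ord natrX exprVn EFinB.
have H0 := H_gt0 d2 g0 q0 scales; have qm := ltn_ord (j m).
rewrite grid_sub01; [|nia|nia].
rewrite -natrB; last by nia.
have -> : (2 * H * (j m).+1 - 2 * H * j m = 2 * H)%N by nia.
rewrite /mesh (natrM _ q) invfM mulrCA divff ?mulr1//.
by rewrite pnatr_eq0; lia.
Qed.

Definition gadget_event j (s : placement) : set T :=
  \bigcap_(i in [set` [fset i in iota 0 (q ^ d)]%fset]) (X i @^-1` target j s i).

Lemma gadget_eventP j s w : gadget_event j s w <->
  forall i, (i < q ^ d)%N -> target j s i (X i w).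
Proof.
split=> [h i iq|h i /=]; first by apply: h; rewrite /= !inE mem_iota.
by rewrite !inE mem_iota; exact: h.
Qed.

Lemma measurable_gadget_event j s : measurable (gadget_event j s).
Proof.
apply: fin_bigcap_measurable; first exact: finite_fset.
move=> i _; rewrite -[X in measurable X]setTI.
by apply: measurable_funPT => //; exact: measurable_target.
Qed.

(** By independence the probability is a product: one box volume for each placed index, and
    [1 - 1/n] for each of the at most [n] others, where [n] is [q ^ d]. *)
Lemma prob_gadget_event j (s : placement) : injective s ->
  (((mesh R H q ^+ d) ^+ (k * k * g) * expR (- 2))%:E <=
   P (gadget_event j s))%E.
Proof.
move=> inj_s; rewrite X_independent; last by move=> i; exact: measurable_target.
rewrite (perm_big (iota 0 (q ^ d))) /=; last first.
  by apply: uniq_perm; rewrite ?fset_uniq ?iota_uniq// => i; rewrite !inE.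
rewrite -{1}(subn0 (q ^ d)%N) -[iota _ _]/(index_iota _ _) big_mkord.
pose a : R := mesh R H q ^+ d; pose b : R := 1 - (q ^ d)%:R^-1.
rewrite (eq_bigr (fun i => (if i \in codom s then a else b)%:E)); last first.
  move=> i _; case: ifP => [/codomP[l ->]|ni].
    by rewrite target_in// prob_box.
  have -> : target j s i = ~` gcell j.
    rewrite /target; case: pickP => // l /eqP/val_inj El.
    by move: ni; rewrite -El codom_f.
  exact: prob_outside_cell.
rewrite prodEFin lee_fin (bigID (mem (codom s))) /=.
rewrite (eq_bigr (fun=> a)) => [|i ->//]; rewrite prodr_const card_codom//.
rewrite [X in _ <= _ * X](eq_bigr (fun=> b)) => [|i /negbTE->//].
have -> : #|labels| = (k * k * g)%N by rewrite !card_prod !card_ord.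
have a0 : 0 <= a by rewrite exprn_ge0// ltW.
apply: (ler_wpM2l (exprn_ge0 _ a0)).
apply: le_trans (exp_neg2_le R n2) _.
have b01 : 0 <= b <= 1.
  rewrite /b subr_ge0 gerBl invr_ge0 ler0n andbT invf_le1 ?ler1n ?ltr0n//; lia.
rewrite prodr_const -/b; apply: ler_wiXn2l; [by lra|by lra|].
by rewrite (leq_trans (max_card _))// card_ord.
Qed.

(** Summing over placements as well as cells makes the expectation a plain sum; a cell still
    contributes at most 1, by [gadget_event_inj]. *)
Definition gadget_count (w : T) : R :=
  \sum_(js <- enum [predX {: cells} & [pred s : placement | injectiveb s]])
    \1_(gadget_event js.1 js.2) w.

Lemma size_placements :
  size (enum [predX {: cells} & [pred s : placement | injectiveb s]]) =
  (q ^ d * (q ^ d) ^_ (k * k * g))%N.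
Proof.
rewrite -cardE cardX card_ffun !card_ord; congr (_ * _)%N.
have -> : (k * k * g)%N = #|labels| by rewrite !card_prod !card_ord.
by rewrite -[X in X ^_ _](card_ord (q ^ d)) -card_inj_ffuns cardsE.
Qed.

Lemma measurable_gadget_count : measurable_fun [set: T] gadget_count.
Proof.
apply: measurable_sum => js.
by apply: measurable_indic; exact: measurable_gadget_event.
Qed.

Lemma gadget_count_ge0 w : 0 <= gadget_count w.
Proof. by apply: sumr_ge0. Qed.

(** A box has volume [1 / (n * B)] and there are at least [(n / 2) ^ G] injective placements per
    cell, so the powers of [n] cancel and each cell contributes a constant. *)
Lemma expected_gadget_count : (2 * (k * k * g) <= q ^ d)%N ->
  (((q ^ d)%:R * (((2 * (2 * H) ^ d)%:R^-1) ^+ (k * k * g) * expR (- 2)))%:E <=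
  \int[P]_w (gadget_count w)%:E)%E.
Proof.
set G := (k * k * g)%N; set n := (q ^ d)%N; set B := ((2 * H) ^ d)%N => Gn.
rewrite /gadget_count; under eq_integral do rewrite -sumEFin.
rewrite ge0_integral_sum//; last first.
  move=> js; apply/measurable_EFinP; apply: measurable_indic.
  exact: measurable_gadget_event.
set a : R := (mesh R H q ^+ d) ^+ G * expR (- 2).
apply: (@le_trans _ _ (\sum_(js <- enum [predX {: cells} &
    [pred s : placement | injectiveb s]]) a%:E)%E); last first.
  rewrite big_seq [leRHS]big_seq; apply: lee_sum => -[j s].
  rewrite mem_enum !inE /= => /injectiveP inj_s.
  rewrite integral_indic ?setIT//; first exact: prob_gadget_event.
  exact: measurable_gadget_event.
rewrite sumEFin lee_fin big_const_seq count_predT size_placements iter_addr_0.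
rewrite -/n -/G -[leRHS]mulr_natl (natrM _ n) -mulrA ler_wpM2l// /a mulrA.
rewrite ler_wpM2r ?expR_ge0//.
have n0 : 0 < n%:R :> R by rewrite ltr0n; lia.
have H0 := H_gt0 d2 g0 q0 scales.
have -> : mesh R H q ^+ d = n%:R^-1 * B%:R^-1 :> R.
  by rewrite /mesh exprVn -natrX expnMn natrM invfM.
apply: (@le_trans _ _ ((n%:R / 2) ^+ G * (n%:R^-1 * B%:R^-1) ^+ G)).
  rewrite -exprMn le_eqVlt; apply/orP; left; apply/eqP; congr (_ ^+ _).
  have B0 : B%:R != 0 :> R by rewrite pnatr_eq0 expn_eq0; lia.
  by rewrite natrM; field; rewrite B0 gt_eqF.
apply: ler_wpM2r; first by rewrite exprn_ge0// mulr_ge0.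
apply: (@le_trans _ _ ((n - G)%N%:R ^+ G)); last first.
  by rewrite -natrX ler_nat ffact_ge.
apply: lerXn2r; rewrite ?nnegrE ?divr_ge0// natrB; last by lia.
have : (2 * G)%:R <= n%:R :> R by rewrite ler_nat.
by rewrite natrM; lra.
Qed.

(** The point with index [s l] lies in the cell, so [s'] must place it too, and disjointness of the
    boxes gives it the same label. *)
Lemma gadget_event_inj j (s s' : placement) w : injective s -> injective s' ->
  gadget_event j s w -> gadget_event j s' w -> s = s'.
Proof.
move=> inj_s inj_s' /gadget_eventP Es /gadget_eventP Es'; apply/ffunP => l.
have := Es _ (ltn_ord (s l)); rewrite target_in// => bl.
have [[l' /val_inj El' bl']|] := target_cases (Es' _ (ltn_ord (s l))).
  by rewrite El' (box_inj d2 g0 q0 scales bl bl').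
by case; apply: (box_sub_cell d2 g0 q0 scales bl).
Qed.

Lemma random_pointsP (N : nat) w x :
  reflect (exists2 i, (i < N)%N & x = X i w) (x \in random_points X N w).
Proof.
apply: (iffP idP) => [/imfsetP[i /= iN ->]|[i iN ->]].
  by exists i => //; move: iN; rewrite mem_iota.
by apply/imfsetP; exists i => //=; rewrite mem_iota.
Qed.

Lemma gadget_count_cells w : exists J : seq cells,
  [/\ uniq J, gadget_count w <= (size J)%:R &
    {in J, forall j, exists2 s : placement, injective s & gadget_event j s w}].
Proof.
pose good j := `[< exists2 s : placement, injective s & gadget_event j s w >].
exists [seq j <- enum {: cells} | good j]; split.
- by rewrite filter_uniq// enum_uniq.
- rewrite /gadget_count big_enum /= (eq_bigl (fun js : cells * placement =>
    predT js.1 && injectiveb js.2)); last by move=> [j s]; rewrite !inE.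
  rewrite -(pair_big predT (fun s : placement => injectiveb s)
    (fun j s => \1_(gadget_event j s) w)) /=.
  rewrite -sum1_size big_filter natr_sum big_enum_cond /= [leRHS]big_mkcond /=.
  apply: ler_sum => j _; case: ifP => [/asboolP[s inj_s Es]|ngood].
    rewrite (bigD1 s) /=; last exact/injectiveP.
    rewrite big1 ?addr0 ?indicE ?leq_b1 ?ler_nat ?leq_b1//.
    move=> s' /andP[/injectiveP inj_s' /eqP ss']; rewrite indicE memNset//.
    by move=> Es'; apply: ss'; exact: gadget_event_inj Es' Es.
  rewrite big1// => s /injectiveP inj_s; rewrite indicE memNset// => Es.
  by move/asboolP: ngood; apply; exists s.
by move=> j; rewrite mem_filter => /andP[/asboolP].
Qed.

Lemma TF_gadget_count w : (3 <= g)%N -> 0 < gadget_count w ->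
  TF g (random_points X (q ^ d) w) + gadget_count w * mesh R H q <=
  TF g.+1 (random_points X (q ^ d) w).
Proof.
move=> g3 c0; have [J [uJ cJ EJ]] := gadget_count_cells w.
have [s sE] : exists s : cells -> placement,
    {in J, forall j, injective (s j) /\ gadget_event j (s j) w}.
  suff : forall j, exists s : placement,
      j \in J -> injective s /\ gadget_event j s w.
    by move=> /choice[s sE]; exists s.
  move=> j; case: (boolP (j \in J)) => [/EJ[s inj_s Es]|_]; first by exists s.
  (* An arbitrary value for the cells outside [J]. *)
  by exists [ffun=> Ordinal (ltnW n2)].
have J0 : (0 < size J)%N by rewrite -(ltr_nat R); exact: lt_le_trans cJ.
apply: le_trans (@TF_gadgets R d g k A H q d2 g0 q0 scales
  _ J (fun j l => X (s j l) w) g3 uJ J0 _ _).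
- by rewrite lerD2l ler_wpM2r// ltW.
- move=> j jJ l; have [inj_s /gadget_eventP Es] := sE j jJ; split.
    by have := Es _ (ltn_ord (s j l)); rewrite target_in.
  by apply/random_pointsP; exists (s j l).
move=> j jJ _ /random_pointsP[i iq ->]; have [inj_s /gadget_eventP Es] := sE j jJ.
have [[l -> _]|] := target_cases (Es i iq); last by right.
by left; exists l.
Qed.

End GadgetEvents.

(** * Strict monotonicity *)

Lemma cvg_powers (d : nat) : (0 < d)%N -> (q.+2 ^ d)%N @[q --> \oo] --> \oo.
Proof.
move=> d0 A [N _ NA]; exists N => //= q Nq; apply: NA => /=.
apply: leq_trans (leq_pexp2l (ltn0Sn _) d0); rewrite expn1.
exact: leq_trans Nq (leqW (leqnSn q)).
Qed.

Lemma powR_scale (R : realType) (d q : nat) : (0 < d)%N ->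
  (q.+2 ^ d)%:R `^ ((d%:R - 1) / d%:R) = q.+2%:R ^+ d.-1 :> R.
Proof.
case: d => // d _; rewrite natrX -powR_mulrn// -powRrM mulrCA divff ?mulr1.
  by rewrite -[d.+1%:R]natr1 addrK powR_mulrn.
by rewrite pnatr_eq0.
Qed.

Lemma beta_step (R : realType) (d : nat) (d_ge2 : (2 <= d)%N)
  (disp : measure_display) (T : measurableType disp) (P : probability T R)
  (X : nat -> {RV P >-> d.-tuple R})
  (X_uniform : forall i, uniform_cube (X i))
  (X_independent : independent_RVs X) (g : nat) (b0 b1 : R) : (3 <= g)%N ->
  is_beta_TF X g b0 -> is_beta_TF X g.+1 b1 -> b0 < b1.
Proof.
move=> g3 beta0 beta1; rewrite ltNge; apply/negP => b10.
have d0 : (0 < d)%N by exact: ltnW.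
have g0 : (0 < g)%N by exact: leq_trans g3.
have [A [k [H scales]]] := gadget_scales_exist d0 g0.
have Q2 q : (2 <= q.+2)%N by [].
pose h q (w : T) : R := (q.+2 ^ d)%:R^-1 * gadget_count g k A H q.+2 X w.
have H0 : (0 < H)%N := H_gt0 d_ge2 g0 (ltn0Sn 0) scales.
have Qd0 q : 0 < (q.+2 ^ d)%:R :> R by rewrite ltr0n expn_gt0.
have c0 q w : 0 <= gadget_count g k A H q.+2 X w by exact: gadget_count_ge0.
have h0 q w : 0 <= h q w by rewrite /h mulr_ge0.
have h1 q w : h q w <= 1.
  rewrite /h mulrC ler_pdivrMr// mul1r.
  have [J [uJ cJ _]] := gadget_count_cells d_ge2 g0 (Q2 q) scales X w.
  apply: le_trans cJ _; rewrite ler_nat.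
  have <- : #|{: {ffun 'I_d -> 'I_q.+2}}| = (q.+2 ^ d)%N.
    by rewrite card_ffun !card_ord.
  rewrite cardE; apply: uniq_leq_size => // x _; exact: mem_enum.
(* A gadget saves [mesh], which is [1 / (2 * H * q)] for [q] cells per axis, whence the factor
   [2 * H]. Since [b1 <= b0], centring the two ratios at their limits only increases their
   difference; the absolute value also covers the case of no gadget. *)
have hbound q w (r := fun g' => TF g' (random_points X (q.+2 ^ d) w) /
    (q.+2 ^ d)%:R `^ ((d%:R - 1) / d%:R)) :
    h q w <= (2 * H)%:R * `|(r g.+1 - b1) - (r g - b0)|.
  move: (c0 q w); rewrite le_eqVlt => /orP[/eqP cw|cw].
    by rewrite /h -cw mulr0 mulr_ge0.
  have tf := TF_gadget_count d_ge2 g0 (Q2 q) scales g3 cw.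
  have q0 : 0 < q.+2%:R ^+ d.-1 :> R by rewrite exprn_gt0.
  apply: (@le_trans _ _ ((2 * H)%:R * (r g.+1 - r g))); last first.
    rewrite ler_wpM2l//; apply: le_trans (ler_norm _); lra.
  rewrite /r powR_scale// -mulrBl.
  have -> : h q w = (2 * H)%:R *
      (gadget_count g k A H q.+2 X w * mesh R H q.+2 / q.+2%:R ^+ d.-1).
    have -> : h q w = (q.+2%:R * q.+2%:R ^+ d.-1)^-1 *
        gadget_count g k A H q.+2 X w.
      by rewrite /h -exprS prednK// natrX.
    rewrite /mesh !natrM; field.
    by rewrite (gt_eqF q0) -(natrD _ 2 q) !pnatr_eq0 -lt0n H0.
  apply: ler_wpM2l => //; apply: ler_wpM2r; first by rewrite invr_ge0 ltW.
  by rewrite lerBrDl.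
have cvgh : {ae P, forall w, [set: T] w -> (h q w)%:E @[q --> \oo] --> 0%E}.
  apply: filterS2 beta0 beta1 => w cw0 cw1 _.
  apply: cvg_EFin; first exact: nearW.
  have sub (g' : nat) b : TF g' (random_points X n w) /
      n%:R `^ ((d%:R - 1) / d%:R) @[n --> \oo] --> b ->
      TF g' (random_points X (q.+2 ^ d) w) /
      (q.+2 ^ d)%:R `^ ((d%:R - 1) / d%:R) - b @[q --> \oo] --> (0 : R).
    move=> cw; rewrite -(subrr b); apply: cvgB; last exact: cvg_cst.
    exact: (cvg_comp _ _ (cvg_powers d0) cw).
  apply: (squeeze_cvgr _ (cvg_cst 0)).
    by apply: nearW => q; rewrite h0; exact: hbound.
  have -> : 0 = (2 * H)%:R * `|(0 : R) - 0| :> R.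
    by rewrite subrr normr0 mulr0.
  by apply: cvgMr; apply: cvg_norm; apply: cvgB; exact: sub.
have mh q : measurable_fun [set: T] (fun w => (h q w)%:E).
  apply/measurable_EFinP; apply: measurable_funM => //.
  exact: measurable_gadget_count.
have hle : {ae P, forall w q, [set: T] w -> (`|(h q w)%:E| <= cst 1 w)%E}.
  by apply: aeW => w q _; rewrite gee0_abs lee_fin.
(* The proportion [h q] is at most 1 and tends to 0 almost surely, so its mean tends to 0. *)
have [_ _ cvgI] := @dominated_convergence _ _ _ P _ measurableT
  (fun q w => (h q w)%:E) (cst 0%E) (cst 1%E) mh (measurable_cst _) cvgh
  (finite_measure_integrable_cst P 1 measurableT) hle.
pose c : R := ((2 * (2 * H) ^ d)%:R^-1) ^+ (k * k * g) * expR (- 2).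
have c_gt0 : 0 < c.
  rewrite mulr_gt0 ?expR_gt0// exprn_gt0// invr_gt0 ltr0n muln_gt0 expn_gt0.
  by lia.
have : (c%:E <= 0)%E.
  rewrite -(integral0 P setT) -(cvg_lim _ cvgI)//; apply: lime_ge.
    by apply/cvg_ex; eexists; exact: cvgI.
  (* From here on the number of cells is large enough for the mean of [h q] to be at least [c]. *)
  exists (2 * (k * k * g))%N => //= q Gq.
  rewrite (eq_integral (fun w => ((q.+2 ^ d)%:R^-1)%:E *
    (gadget_count g k A H q.+2 X w)%:E)%E)//.
  rewrite ge0_integralZl_EFin//; last 2 first.
  - by move=> x _; rewrite lee_fin c0.
  - apply/measurable_EFinP; exact: measurable_gadget_count.
  rewrite lee_pdivlMl//; apply: expected_gadget_count => //.
  apply: leq_trans (leq_pexp2l (ltn0Sn _) d0); rewrite expn1.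
  exact: leq_trans Gq (leqW (leqnSn q)).
by rewrite lee_fin leNgt c_gt0.
Qed.

Theorem theorem1p3 (R : realType) (d : nat) (d_ge2 : (2 <= d)%N)
  (disp : measure_display) (T : measurableType disp) (P : probability T R)
  (X : nat -> {RV P >-> d.-tuple R})
  (X_uniform : forall i, uniform_cube (X i))
  (X_independent : independent_RVs X)
  (beta : nat -> R)
  (beta_def : forall g, (3 <= g)%N -> is_beta_TF X g (beta g)) :
  forall g h, (3 <= g)%N -> (g < h)%N -> beta g < beta h.
Proof.
move=> g h g3.
have step h' : (g <= h')%N -> beta h' < beta h'.+1.
  move=> gh; have h3 := leq_trans g3 gh.
  apply: (@beta_step _ _ d_ge2 _ _ _ _ X_uniform X_independent) (h3) _ _.
    exact: beta_def.
  by apply: beta_def; exact: ltnW.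
elim: h => // h IH; rewrite ltnS leq_eqVlt => /orP[/eqP <-|gh].
  exact: step.
by apply: lt_trans (IH gh) (step _ _); exact: ltnW.
Qed.
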